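(* Every graph $G$ of stability at most two is b-monotonic; that is, $\chi_b(H_1) \geq \chi_b(H_2)$ for every induced subgraph $H_1$ of $G$ and every induced subgraph $H_2$ of $H_1$.
   Context: Graphs are finite and simple. The stability of a graph is the maximum cardinality of a set of pairwise non-adjacent vertices. A b-coloring of a graph with $t$ colors is a proper coloring of the vertices with $t$ colors such that every color class contains a vertex that is adjacent to all other $t-1$ color classes. The b-chromatic number $\chi_b(G)$ is the maximum $t$ such that $G$ admits a b-coloring with $t$ colors. *)

(* Defs.v *)
From mathcomp Require Import all_boot.

Set Implicit Arguments.
Unset Strict Implicit.
Unset Printing Implicit Defensive.

Record sgraph := SGraph {
  vertex :> finType;
  adj : rel vertex;
  adj_sym : symmetric adj;
  adj_irrefl : irreflexive adj }.

Section Induced.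
Variables (G : sgraph) (S : {set G}).

Definition induced_adj : rel {x : G | x \in S} :=
  fun x y => adj (val x) (val y).

Lemma induced_adj_sym : symmetric induced_adj.
Proof. by move=> x y; apply: adj_sym. Qed.

Lemma induced_adj_irrefl : irreflexive induced_adj.
Proof. by move=> x; apply: adj_irrefl. Qed.

Definition induced : sgraph := SGraph induced_adj_sym induced_adj_irrefl.

End Induced.

Section Coloring.
Variable G : sgraph.

Definition stable (S : {set G}) : bool :=
  [forall x in S, forall y in S, ~~ adj x y].

Definition stability : nat := \max_(S : {set G} | stable S) #|S|.

Definition proper_coloring t (f : {ffun G -> 'I_t}) : bool :=
  [forall x : G, forall y : G, adj x y ==> (f x != f y)].

Definition b_vertex t (f : {ffun G -> 'I_t}) (v : G) : bool :=
  [forall j : 'I_t, (j != f v) ==> [exists w : G, adj v w && (f w == j)]].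

Definition b_coloring t (f : {ffun G -> 'I_t}) : bool :=
  proper_coloring f &&
  [forall i : 'I_t, exists v : G, (f v == i) && b_vertex f v].

Definition b_colorable t : bool :=
  [exists f : {ffun G -> 'I_t}, b_coloring f].

(* All the color classes of a b-coloring are nonempty. *)
Lemma b_colorable_le_card t : b_colorable t -> t <= #|G|.
Proof.
case/existsP=> f /andP[_ /forallP fb].
rewrite -[t in t <= _]card_ord.
apply: leq_trans (leq_image_card f G).
apply/subset_leq_card/subsetP=> i _.
by have /existsP[v /andP[/eqP <- _]] := fb i; apply: image_f.
Qed.

(* Restricting to t <= #|G| loses nothing, by b_colorable_le_card. *)
Definition chi_b : nat := \max_(t < #|G|.+1 | b_colorable t) t.

Lemma leq_chi_b t : b_colorable t -> t <= chi_b.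
Proof.
move=> tG; have lt_t : t < #|G|.+1 by rewrite ltnS b_colorable_le_card.
exact: (@leq_bigmax_cond _ _ (fun i : 'I_#|G|.+1 => i : nat) (Ordinal lt_t)).
Qed.

End Coloring.

(* S2 is a set of vertices of the graph induced G S1, so that induced S2 is an
   induced subgraph of induced S1; either set may be empty. *)
Definition b_monotonic (G : sgraph) : Prop :=
  forall (S1 : {set G}) (S2 : {set induced S1}),
    chi_b (induced S1) >= chi_b (induced S2).

(* Main.v *)
Require Import Defs.
From mathcomp Require Import all_boot.

Set Implicit Arguments.
Unset Strict Implicit.
Unset Printing Implicit Defensive.

(** When the stability is at most two, color classes have at most two elements
  and a vertex outside a two-element class has a neighbor in it. Hence a vertex
  is a b-vertex as soon as it is adjacent to all the other singleton classes.
  In the complement, a coloring is a matching, and it is a b-coloring iff this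
  matching has no augmenting path of length 1 or 3. When a vertex [v] is added,
  either it can form a new color class, or there is such an augmenting path
  from [v]; augmenting along it (along a path of length 1 if there is one)
  keeps the number of colors and leaves no short augmenting path. *)

Lemma stability2_adj (G : sgraph) (x y z : G) : stability G <= 2 ->
  x != y -> x != z -> y != z -> [|| adj x y, adj x z | adj y z].
Proof.
move=> stG nxy nxz nyz; apply: contraLR stG; rewrite !negb_or -ltnNge.
case/and3P=> axy axz ayz.
suff st : stable [set x; y; z].
  have := @leq_bigmax_cond _ (@stable G) (fun S : {set G} => #|S|) _ st.
  apply: leq_trans.
  by rewrite -setUA cardsU1 cards2 !inE negb_or nxy nxz nyz.
apply/forall_inP=> a; rewrite !inE => /orP[/orP[]|] /eqP->;
  apply/forall_inP=> b; rewrite !inE => /orP[/orP[]|] /eqP->;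
  by rewrite ?adj_irrefl // adj_sym.
Qed.

(** * B-colorings of vertex subsets, in terms of singleton classes *)

Section SubsetColoring.
Variable G : sgraph.
Implicit Types (S T : {set G}) (f : G -> nat) (t : nat).

Definition lonely S f (u : G) : bool :=
  (u \in S) && [forall y in S, (f y == f u) ==> (y == u)].

Lemma lonelyP S f u :
  reflect (u \in S /\ {in S, forall y, f y = f u -> y = u}) (lonely S f u).
Proof.
apply: (iffP andP) => -[uS lu]; split=> //.
  by move=> y yS fy; apply/eqP; move/forall_inP/(_ y yS): lu; rewrite fy eqxx.
by apply/forall_inP=> y yS; apply/implyP=> /eqP/(lu y yS)->.
Qed.

Arguments lonelyP {S f u}.

Definition dominating S f (z : G) : bool :=
  [forall u, lonely S f u ==> (u != z) ==> adj z u].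

Lemma dominatingP S f z :
  reflect (forall u, lonely S f u -> u != z -> adj z u) (dominating S f z).
Proof.
apply: (iffP forallP) => [dz u lu uz|dz u].
  by have := dz u; rewrite lu uz.
by apply/implyP=> lu; apply/implyP; apply: dz.
Qed.

Arguments dominatingP {S f z}.

(* The b-colorings of the subgraph induced by [S]; the values of [f] outside
   [S] are irrelevant. *)
Definition subset_b_coloring S t f : Prop :=
  [/\ {in S, forall x, f x < t},
      {in S &, forall x y, adj x y -> f x != f y}
    & forall i, i < t -> exists2 z, z \in S & (f z == i) && dominating S f z].

(** * Extending a coloring by one vertex *)

Hypothesis stG : stability G <= 2.

Lemma nadj_adj (x y z : G) :
  x != y -> x != z -> y != z -> ~~ adj x y -> ~~ adj x z -> adj y z.
Proof.
move=> nxy nxz nyz /negPf axy /negPf axz.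
by have := stability2_adj stG nxy nxz nyz; rewrite axy axz.
Qed.

(** Augmentation along the path [v], [u] of the complement. No singleton class is created, so
    dominating vertices remain dominating. *)
Lemma subset_b_coloring_join_lonely S t f u v :
  subset_b_coloring S t f -> v \notin S -> lonely S f u -> ~~ adj v u ->
  subset_b_coloring (v |: S) t (fun x => if x == v then f u else f x).
Proof.
move=> bf vS lu avu; have [ltf pf domf] := bf; have [uS luS] := elimT lonelyP lu.
set g := fun x => _.
have inSv x : x \in S -> (x == v) = false.
  by move=> xS; apply: contraNF vS => /eqP<-.
have gS x : x \in S -> g x = f x by move=> xS; rewrite /g inSv.
have gv : g v = f u by rewrite /g eqxx.
have lg w : lonely (v |: S) g w -> lonely S f w.
  case/lonelyP=> /setU1P[->|wS] lw.
    have := lw u (setU1r v uS); rewrite gv gS // => /(_ erefl) uv.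
    by rewrite -uv uS in vS.
  apply/lonelyP; split=> // y yS fy.
  by apply: lw; rewrite ?gS // setU1r.
have dg z : dominating S f z -> dominating (v |: S) g z.
  by move/dominatingP=> dz; apply/dominatingP=> w /lg; apply: dz.
split.
- by move=> x /setU1P[->|xS]; rewrite ?gv ?gS ?ltf.
- have pv y : y \in S -> adj v y -> f u != f y.
    by move=> yS; apply: contraTneq => /esym/(luS y yS)->.
  move=> x y /setU1P[->|xS] /setU1P[->|yS]; rewrite ?gv ?gS //.
  + by rewrite adj_irrefl.
  + exact: pv.
  + by rewrite adj_sym eq_sym; apply: pv.
  + exact: pf.
- move=> i /domf[z zS /andP[fz dz]].
  by exists z; rewrite ?setU1r // gS // fz dg.
Qed.

(** The only new singleton class is that of [v], so the old representatives need only be adjacent to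
    [v] in addition; [v] represents the color [t]. *)
Lemma subset_b_coloring_new_color S t f v :
  subset_b_coloring S t f -> v \notin S ->
  (forall u, lonely S f u -> adj v u) ->
  (forall i, i < t -> exists2 z, z \in S &
     [&& f z == i, dominating S f z & adj z v]) ->
  subset_b_coloring (v |: S) t.+1 (fun x => if x == v then t else f x).
Proof.
move=> [ltf pf _] vS av domf.
set g := fun x => _.
have inSv x : x \in S -> (x == v) = false.
  by move=> xS; apply: contraNF vS => /eqP<-.
have gS x : x \in S -> g x = f x by move=> xS; rewrite /g inSv.
have gv : g v = t by rewrite /g eqxx.
have lg w : lonely (v |: S) g w -> w = v \/ lonely S f w.
  case/lonelyP=> /setU1P[->|wS] lw; [by left|right].
  by apply/lonelyP; split=> // y yS fy; apply: lw; rewrite ?gS // setU1r.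
split.
- by move=> x /setU1P[->|xS]; rewrite ?gv ?gS // ltnW // ltnS ltf.
- move=> x y /setU1P[->|xS] /setU1P[->|yS]; rewrite ?gv ?gS //.
  + by rewrite adj_irrefl.
  + by move=> _; rewrite gtn_eqF ?ltf.
  + by move=> _; rewrite ltn_eqF ?ltf.
  + exact: pf.
- move=> i; rewrite ltnS leq_eqVlt => /orP[/eqP->|/domf].
    exists v; rewrite ?setU11 // gv eqxx.
    by apply/dominatingP=> w /lg[->|/av //]; rewrite eqxx.
  case=> z zS /and3P[fz /dominatingP dz azv].
  exists z; rewrite ?setU1r // gS // fz.
  by apply/dominatingP=> w /lg[->|/dz].
Qed.

(** Augmentation along the path [v], [x], [y], [u] of the complement: the classes of [x, y] and of
    [u] become those of [v, x] and of [y, u]. Again no singleton class is created. *)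
Lemma subset_b_coloring_augment3 S t f u v x y :
    subset_b_coloring S t f -> v \notin S ->
    (forall w, lonely S f w -> adj v w) ->
    x \in S -> y \in S -> f y = f x -> y != x -> ~~ adj x v ->
    lonely S f u -> u != y -> ~~ adj y u ->
  subset_b_coloring (v |: S) t
    (fun z => if z == v then f x else if z == y then f u else f z).
Proof.
move=> bf vS av xS yS fyx nyx axv lu nuy ayu.
have [ltf pf domf] := bf; have [uS luS] := elimT lonelyP lu.
set g := fun z => _.
have inSv z : z \in S -> (z == v) = false.
  by move=> zS; apply: contraNF vS => /eqP<-.
have gv : g v = f x by rewrite /g eqxx.
have gy : g y = f u by rewrite /g inSv // eqxx.
have gS z : z \in S -> z != y -> g z = f z.
  by move=> zS /negPf zy; rewrite /g inSv // zy.
have nfux : f u != f x.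
  apply: contraNneq nuy => fux.
  by rewrite (luS y yS) // fyx fux.
have nadj_same a b : a \in S -> b \in S -> f a = f b -> ~~ adj a b.
  by move=> aS bS fab; apply/negP=> /(pf a b aS bS); rewrite fab eqxx.
(* The class of [x] is exactly [x, y], as a third member would give three pairwise non-adjacent
   vertices. *)
have class_x z : z \in S -> z != y -> f z = f x -> z = x.
  move=> zS nzy fzx; apply/eqP; apply: contraT => nzx.
  have ayz : adj y z.
    by apply: (@nadj_adj x); rewrite 1?eq_sym // nadj_same // ?fyx.
  by have := pf _ _ yS zS ayz; rewrite fyx fzx eqxx.
have pv z : z \in S -> adj v z -> f x != g z.
  move=> zS avz; have [->|nzy] := eqVneq z y; first by rewrite gy eq_sym.
  rewrite gS //; apply: contraNneq axv => fxz.
  by rewrite -(class_x z zS nzy (esym fxz)) adj_sym.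
have py z : z \in S -> adj y z -> f u != f z.
  by move=> zS; apply: contraTneq => /esym/(luS z zS)->.
have lg w : lonely (v |: S) g w -> lonely S f w.
  case/lonelyP=> /setU1P[->|wS] lw.
    have := lw x (setU1r v xS); rewrite gv gS // 1?eq_sym // => /(_ erefl) xv.
    by rewrite -xv xS in vS.
  have nwy : w != y.
    apply/eqP=> wy; have := lw u (setU1r v uS).
    by rewrite wy gy gS // => /(_ erefl)/eqP; apply/negP.
  apply/lonelyP; split=> // z zS fzw.
  (* If [w] shared its old class with [y], it now shares that color with [v]. *)
  have [zy|nzy] := eqVneq z y; last by apply: lw; rewrite ?setU1r ?gS.
  have := lw v (setU11 v S).
  by rewrite gv gS // -fzw zy fyx => /(_ erefl) vw; rewrite vw wS in vS.
have dg z : dominating S f z -> dominating (v |: S) g z.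
  by move/dominatingP=> dz; apply/dominatingP=> w /lg; apply: dz.
split.
- move=> z /setU1P[->|zS]; first by rewrite gv ltf.
  by have [->|nzy] := eqVneq z y; rewrite ?gy ?gS ?ltf.
- move=> a b /setU1P[->|aS] /setU1P[->|bS]; rewrite ?adj_irrefl // ?gv.
  + exact: pv.
  + by rewrite adj_sym eq_sym; apply: pv.
  have [->|nay] := eqVneq a y; have [->|nby] := eqVneq b y.
  + by rewrite adj_irrefl.
  + by rewrite gy gS //; apply: py.
  + by rewrite gy gS // adj_sym eq_sym; apply: py.
  + by rewrite !gS //; apply: pf.
(* The color of [x] may have lost its representative [y]; [v] takes over, being adjacent to all
   lonely vertices. The other colors keep theirs. *)
- move=> i lti; have [->|nix] := eqVneq i (f x).
    exists v; rewrite ?setU11 // gv eqxx.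
    by apply/dominatingP=> w /lg/av.
  have [z zS /andP[/eqP fz dz]] := domf i lti.
  exists z; rewrite ?setU1r // dg // andbT gS ?fz //.
  by apply: contraNneq nix => zy; rewrite -fz zy fyx.
Qed.

Lemma subset_b_coloringU1 S t f v : subset_b_coloring S t f -> v \notin S ->
  exists t' g, t <= t' /\ subset_b_coloring (v |: S) t' g.
Proof.
move=> bf vS; have [ltf pf domf] := bf.
have [/existsP[u /andP[lu avu]]|] :=
    boolP [exists u, lonely S f u && ~~ adj v u].
  exists t; eexists; split=> //.
  exact: subset_b_coloring_join_lonely bf vS lu avu.
rewrite negb_exists => /forallP nav.
have av u : lonely S f u -> adj v u.
  by move=> lu; have := nav u; rewrite lu negbK.
(* The vertices [z] that can still represent color [i] once [v] forms a new class. *)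
pose ext i z := [&& f z == i, dominating S f z & adj z v].
have [/forallP al|] := boolP [forall i : 'I_t, exists z in S, ext i z].
  exists t.+1; eexists; split=> //.
  apply: subset_b_coloring_new_color bf vS av _ => i lti.
  by have /exists_inP := al (Ordinal lti).
(* A color [i] without such a vertex yields the path of length 3. Its representative [x] is not
   adjacent to [v], hence not lonely; a classmate [y] is adjacent to [v], so it cannot be dominating
   and misses some lonely [u]. *)
rewrite negb_forall => /existsP[i]; rewrite negb_exists_in => /forall_inP noz.
have [x xS /andP[/eqP fx dx]] := domf i (ltn_ord i).
have axv : ~~ adj x v by have := noz x xS; rewrite /ext fx eqxx dx.
have : ~~ lonely S f x by apply: contraNN axv => /av; rewrite adj_sym.
rewrite /lonely xS negb_forall_in => /exists_inP[y yS].
rewrite negb_imply => /andP[/eqP fy nyx].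
have nSv z : z \in S -> z != v by move=> zS; apply: contraNneq vS => <-.
have axy : ~~ adj x y by apply/negP=> /(pf _ _ xS yS); rewrite fy eqxx.
have ayv : adj y v by apply: (@nadj_adj x); rewrite 1?eq_sym // eq_sym nSv.
have := noz y yS; rewrite /ext fy fx eqxx ayv andbT negb_forall.
case/existsP=> u; rewrite !negb_imply => /and3P[lu nuy ayu].
exists t; eexists; split=> //.
exact: subset_b_coloring_augment3 bf vS av xS yS fy nyx axv lu nuy ayu.
Qed.

Lemma subset_b_coloring_mono S T t f : S \subset T ->
  subset_b_coloring S t f ->
  exists t' g, t <= t' /\ subset_b_coloring T t' g.
Proof.
move: {2}#|_| (leqnn #|T :\: S|) => n.
elim: n S t f => [|n IHn] S t f; [rewrite leqn0 cards_eq0 setD_eq0|] => leTS sST bf.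
  by exists t, f; split=> //; have -> : T = S by apply/eqP; rewrite eqEsubset leTS.
have [/eqP|[v]] := set_0Vmem (T :\: S).
  rewrite setD_eq0 => sTS.
  by exists t, f; split=> //; have -> : T = S by apply/eqP; rewrite eqEsubset sTS.
move=> vTS; have /setDP[vT vS] := vTS.
have [t1 [g [le_t bg]]] := subset_b_coloringU1 bf vS.
have [||t2 [h [le_t1 bh]]] := IHn _ _ _ _ _ bg.
- by move: leTS; rewrite (cardsD1 v) vTS setDDl setUC.
- by rewrite subUset sub1set vT.
by exists t2, h; split=> //; apply: leq_trans le_t le_t1.
Qed.

(** * Transfer between induced subgraphs and vertex subsets *)

Section Embedding.
Variables (H : sgraph) (e : H -> G) (S : {set G}).
Hypotheses (e_inj : injective e) (e_adj : forall x y, adj (e x) (e y) = adj x y).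
Hypothesis e_im : forall x, (x \in S) = (x \in codom e).

(** A b-vertex has a neighbor in every other class; in a singleton class, this neighbor is the only
    member. *)
Lemma subset_of_b_colorable t :
  b_colorable H t -> exists f, subset_b_coloring S t f.
Proof.
case/existsP=> f /andP[/forallP pf /forallP bf].
(* The default 0 is taken only outside the image of [e], which is [S]. *)
pose g x := if [pick h | e h == x] is Some h then f h : nat else 0.
have ge h : g (e h) = f h.
  rewrite /g; case: pickP => [k /eqP/e_inj->//|/(_ h)]; by rewrite eqxx.
have eS h : e h \in S by rewrite e_im codom_f.
exists g; split.
- by move=> x; rewrite e_im => /codomP[h ->]; rewrite ge.
- move=> x y; rewrite !e_im => /codomP[h ->] /codomP[k ->].
  rewrite !ge e_adj => ahk.
  by have /forallP/(_ k) := pf h; rewrite ahk.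
- move=> i lti; have /existsP[h /andP[/eqP fh /forallP bh]] := bf (Ordinal lti).
  exists (e h); rewrite // ge fh eqxx; apply/dominatingP=> u /lonelyP[].
  rewrite {1}e_im => /codomP[k ->] lk nkh; rewrite e_adj.
  have nf : f k != f h.
    apply: contraNneq nkh => fkh; apply/eqP/esym/lk; rewrite ?eS // !ge.
    by rewrite fkh.
  have := bh (f k); rewrite nf => /existsP[w /andP[ahw /eqP fw]].
  by have := lk (e w) (eS w); rewrite !ge fw => /(_ erefl)/e_inj <-.
Qed.

(** This direction uses the stability bound, to find neighbors in the classes that are not
    singletons. *)
Lemma b_colorable_of_subset t f : subset_b_coloring S t f -> b_colorable H t.
Proof.
case=> ltf pf domf.
have eS h : e h \in S by rewrite e_im codom_f.
pose g := [ffun h => Ordinal (ltf (e h) (eS h))].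
have ge h : g h = f (e h) :> nat by rewrite ffunE.
apply/existsP; exists g; apply/andP; split.
  apply/forallP=> h; apply/forallP=> k; apply/implyP=> ahk.
  by rewrite -val_eqE /= !ge pf // e_adj.
have surj i : i < t -> exists h, f (e h) = i.
  move=> /domf[z]; rewrite e_im => /codomP[h ->] /andP[/eqP fh _].
  by exists h.
apply/forallP=> i; have [z] := domf i (ltn_ord i).
rewrite e_im => /codomP[h ->] /andP[/eqP fh /dominatingP dh].
apply/existsP; exists h; rewrite -val_eqE /= ge fh eqxx /=.
apply/forallP=> j; apply/implyP=> nj.
have [k fk] := surj j (ltn_ord j).
have nfhk : f (e h) != f (e k).
  by rewrite fk -ge eq_sym; apply: contraNneq nj => jh; rewrite -val_eqE /= jh.
have neq a b : f (e a) != f (e b) -> e a != e b by apply: contraNneq => ->.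
apply/existsP; have [ahk|ahk] := boolP (adj h k).
  by exists k; rewrite ahk -val_eqE /= ge fk eqxx.
(* As [h] misses [k], the class of [e k] has another member [e l]; being non-adjacent to both [e h]
   and [e l], [e k] forces these two to be adjacent. *)
have : ~~ lonely S f (e k).
  by apply: contraNN ahk => lk; rewrite -e_adj dh // eq_sym neq.
rewrite /lonely eS negb_forall_in => /exists_inP[y].
rewrite e_im => /codomP[l ->]; rewrite negb_imply => /andP[/eqP flk nlk].
have nakl : ~~ adj (e k) (e l).
  by apply/negP=> /(pf _ _ (eS k) (eS l)); rewrite flk eqxx.
exists l; rewrite -val_eqE /= ge flk fk eqxx andbT -e_adj.
have nkh : e k != e h by rewrite eq_sym neq.
have nhl : e h != e l by rewrite neq // flk.
have nkl : e k != e l by rewrite eq_sym.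
by apply: (nadj_adj nkh nkl nhl); rewrite // e_adj adj_sym.
Qed.

End Embedding.
End SubsetColoring.

Theorem theorem6 (G : sgraph) (hG : stability G <= 2) : b_monotonic G.
Proof.
move=> S1 S2; apply/bigmax_leqP=> t.
have inS1 x : (x \in S1) = (x \in codom (val : induced S1 -> G)).
  apply/idP/codomP=> [xS|[h ->]]; last exact: (valP h).
  by exists (Sub x xS : {x | x \in S1}).
(* Both inclusions are composed, so that the two subgraphs are compared as nested vertex subsets of
   [G]. *)
pose e (h : induced S2) : G := val (val h).
have e_inj : injective e by move=> h k /val_inj/val_inj.
have eE x : (x \in [set x in codom e]) = (x \in codom e) by rewrite inE.
move=> /(subset_of_b_colorable e_inj (fun _ _ => erefl) eE)[f bf].
have [|t' [g [le_t bg]]] := subset_b_coloring_mono (T := S1) hG _ bf.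
  by apply/subsetP=> x; rewrite inE => /codomP[h ->]; apply: (valP (val h)).
apply: leq_trans le_t (leq_chi_b _).
exact: (b_colorable_of_subset hG (H := induced S1) (fun _ _ => erefl) inS1 bg).
Qed.
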